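(* Let $\mathcal M$ be a smooth manifold and let $f\colon\mathcal M\to\mathbb R$, $g=(g^1,\dots,g^m)\colon\mathcal M\to\mathbb R^m$, $h=(h^1,\dots,h^q)\colon\mathcal M\to\mathbb R^q$ be of class $C^1$. Let $\Omega=\{p\in\mathcal M: g(p)\le 0,\ h(p)=0\}$. Suppose that $p^*\in\Omega$ is a local minimizer of $f$ over $\Omega$, and that the Guignard constraint qualification $\mathcal L(\Omega;p^* )^\circ=\mathcal T(\Omega;p^* )^\circ$ holds at $p^*$. Then there exist Lagrange multipliers $\mu\in\mathbb R_m$, $\lambda\in\mathbb R_q$ (row vectors) such that the KKT conditions hold: $$(\mathrm df)(p^* )+\sum_{i=1}^m\mu_i(\mathrm dg^i)(p^* )+\sum_{j=1}^q\lambda_j(\mathrm dh^j)(p^* )=0 \text{ in } \mathcal T^*_{p^*}\mathcal M,$$ $$h(p^* )=0,\qquad \mu\ge 0,\quad g(p^* )\le 0,\quad \mu\,g(p^* )=0.$$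
   Context: A smooth manifold is a Hausdorff, second-countable space with a smooth ($C^\infty$) atlas of dimension $n$ (no boundary, no Riemannian metric). Inequalities between vectors are componentwise. A point $p^*\in\Omega$ is a local minimizer if there is a neighborhood $U$ of $p^*$ with $f(p^* )\le f(p)$ for all $p\in U\cap\Omega$. Tangent vectors at $p$ are those generated by $C^1$-curves $\gamma\colon(-\varepsilon,\varepsilon)\to\mathcal M$ with $\gamma(0)=p$; such a curve generates $[\dot\gamma(0)]$, acting on $C^1$-functions $s$ defined near $p$ by $[\dot\gamma(0)](s)=\frac{\mathrm d}{\mathrm dt}(s\circ\gamma)|_{t=0}$. They form the $n$-dimensional tangent space $\mathcal T_p\mathcal M$, with dual $\mathcal T_p^*\mathcal M$; the differential of $s$ at $p$ is $(\mathrm ds)(p)\,\xi=\xi(s)$. For $p\in\Omega$, the active set is $\mathcal A(p)=\{i: g^i(p)=0\}$. (Bouligand) tangent cone: $\mathcal T(\Omega;p)$ is the set of all $\xi\in\mathcal T_p\mathcal M$ for which there exist sequences $(p_k)\subseteq\Omega$ and $t_k\searrow 0$ (with $t_k>0$) such that for all $C^1$-functions $s$ defined near $p$, $\xi(s)=\lim_{k\to\infty}\frac{s(p_k)-s(p)}{t_k}$ (in particular $p_k\to p$, so that $s(p_k)$ is defined for large $k$). Linearizing cone: $\mathcal L(\Omega;p)=\{\xi\in\mathcal T_p\mathcal M:\ \xi(g^i)\le 0\ \forall i\in\mathcal A(p),\ \xi(h^j)=0\ \forall j=1,\dots,q\}$. Polar cone of $B\subseteq\mathcal T_p\mathcal M$: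 $B^\circ=\{\sigma\in\mathcal T_p^*\mathcal M:\ \sigma\,\xi\le 0\ \forall\xi\in B\}$. *)

(* Defs.v *)
From HB Require Import structures.
From mathcomp Require Import all_boot all_order all_algebra.
From mathcomp Require Import all_classical all_reals all_analysis.

Set Implicit Arguments.
Unset Strict Implicit.
Unset Printing Implicit Defensive.

Import Order.TTheory GRing.Theory Num.Theory.
Import numFieldNormedType.Exports.

Local Open Scope classical_set_scope.
Local Open Scope ring_scope.

(* [Ck k U f]: f is of class C^k on the open set U.  It is only used for
   finite-dimensional V, where continuity of all directional derivatives 'D_v f
   is the same as continuity of the differential.  The values of f outside U
   are irrelevant when U is open. *)
Fixpoint Ck (R : realType) (V W : normedModType R) (k : nat) (U : set V)
    (f : V -> W) : Prop :=
  if k is k'.+1 then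
    (forall x, U x -> differentiable f x) /\ (forall v, Ck k' U ('D_v f))
  else forall x, U x -> {for x, continuous f}.

Definition smooth (R : realType) (V W : normedModType R) (U : set V)
    (f : V -> W) : Prop := forall k, Ck k U f.

(* A chart is a homeomorphism from the open set [chart_dom] onto an open subset
   of R^n.  Both [chart_map] and [chart_inv] are total functions whose values
   matter only on [chart_dom] and on its image respectively. *)
Record chart (R : realType) (n : nat) (M : topologicalType) := Chart {
  chart_dom : set M;
  chart_map :> M -> 'rV[R]_n;
  chart_inv : 'rV[R]_n -> M;
  chart_dom_open : open chart_dom;
  chart_img_open : open (chart_map @` chart_dom);
  chart_mapK : forall x, chart_dom x -> chart_inv (chart_map x) = x;
  chart_map_cts : forall x, chart_dom x -> {for x, continuous chart_map};
  chart_inv_cts : forall y, (chart_map @` chart_dom) y ->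
    {for y, continuous chart_inv} }.

Record smoothManifold (R : realType) (n : nat) := SmoothManifold {
  manifold_space :> topologicalType;
  manifold_hausdorff : hausdorff_space manifold_space;
  manifold_second_countable : @second_countable manifold_space;
  atlas : set (chart R n manifold_space);
  atlas_cover : forall x : manifold_space, exists2 c, atlas c & chart_dom c x;
  atlas_compat : forall c c', atlas c -> atlas c' ->
    smooth (c @` (chart_dom c `&` chart_dom c')) (c' \o chart_inv c) }.

Lemma is_diff_line (R : realType) (V : normedModType R) (a v : V) (t : R) :
  is_diff t (fun t : R => a + t *: v) (fun w : R => w *: v).
Proof.
have ? : is_diff t (fun t : R => t *: v) (fun w : R => w *: v).
  exact: is_diff_scalel.
have -> : (fun w : R => w *: v) = (0 : R -> V) + (fun w : R => w *: v).
  by rewrite add0r.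
exact: (@is_diffD _ _ _ (cst a) (fun t : R => t *: v)).
Qed.

Section C1.
Variables (R : realType) (n : nat) (M : smoothManifold R n).

Definition C1_on (W : normedModType R) (U : set M) (s : M -> W) : Prop :=
  forall c, atlas c -> Ck 1 (c @` (U `&` chart_dom c)) (s \o chart_inv c).

Definition C1 (W : normedModType R) (s : M -> W) : Prop := C1_on setT s.

(* A C^1 function defined near p is represented by an arbitrary total
   extension. *)
Definition C1_near (p : M) (s : M -> R) : Prop :=
  exists2 U : set M, open_nbhs p U & C1_on U s.

(* gamma is a C^1 curve on ]-eps, eps[ with gamma(0) = p. *)
Definition C1_curve (p : M) (eps : R) (gamma : R -> M) : Prop :=
  [/\ gamma 0 = p,
      (forall t, `|t| < eps -> {for t, continuous gamma}) &
      forall c, atlas c ->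
        Ck 1 [set t | `|t| < eps /\ chart_dom c (gamma t)] (c \o gamma)].

(* The action of the velocity of gamma at t = 0 on C^1 functions near p,
   extended by 0 to the functions that are not C^1 near p. *)
Definition velocity (p : M) (gamma : R -> M) (s : M -> R) : R :=
  if `[< C1_near p s >] then derive1 (s \o gamma) 0 else 0.

Definition is_tangent (p : M) : pred ((M -> R) -> R) := fun xi =>
  `[< exists eps gamma, [/\ 0 < eps, C1_curve p eps gamma &
                            xi = velocity p gamma] >].

(* In a chart c at p, the tangent vectors at p are exactly the directional
   derivatives of s \o chart_inv c at c p (lemma [is_tangentP]), so they form
   a vector space. *)
Definition straight (c : chart R n M) (p : M) (v : 'rV[R]_n) (t : R) : M :=
  chart_inv c (c p + t *: v).

Definition chart_tangent (c : chart R n M) (p : M) (v : 'rV[R]_n)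
    (s : M -> R) : R :=
  if `[< C1_near p s >] then 'd (s \o chart_inv c) (c p) v else 0.

Lemma chart_invK (c : chart R n M) y : (c @` chart_dom c) y ->
  c (chart_inv c y) = y.
Proof. by move=> [x cx <-]; rewrite chart_mapK. Qed.

Lemma C1_near_differentiable (c : chart R n M) p s : atlas c ->
  chart_dom c p -> C1_near p s -> differentiable (s \o chart_inv c) (c p).
Proof.
move=> ac cp [U [oU Up] /(_ _ ac)[+ _]]; apply; by exists p.
Qed.

Lemma velocityE (c : chart R n M) p eps gamma : atlas c -> chart_dom c p ->
  0 < eps -> C1_curve p eps gamma ->
  velocity p gamma = chart_tangent c p ('d (c \o gamma) 0 1).
Proof.
move=> ac cp e0 [g0 gc gC]; apply/funext => s; rewrite /velocity /chart_tangent.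
case: asboolP => // sC.
have dg : differentiable (c \o gamma) 0.
  by have [+ _] := gC _ ac; apply => /=; rewrite normr0 g0.
have ds := C1_near_differentiable ac cp sC.
rewrite derive1E; transitivity ('D_1 ((s \o chart_inv c) \o (c \o gamma)) 0).
  apply: near_eq_derive.
  have : \forall t \near (0 : R), chart_dom c (gamma t).
    apply: (gc 0); first by rewrite normr0.
    by rewrite g0; apply: open_nbhs_nbhs; split => //; exact: chart_dom_open.
  by apply: filterS => t ct /=; rewrite chart_mapK.
have ds' : differentiable (s \o chart_inv c) ((c \o gamma) 0) by rewrite /= g0.
rewrite deriveE; last exact: differentiable_comp.
have -> := diff_comp dg ds'.
by rewrite [LHS]/= g0.
Qed.

Lemma straight_C1 (c : chart R n M) p v : atlas c -> chart_dom c p ->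
  exists2 eps, 0 < eps & C1_curve p eps (straight c p v).
Proof.
move=> ac cp.
pose aff (t : R) := c p + t *: v.
have affd t : is_diff t aff (fun w : R => w *: v) by exact: is_diff_line.
have affc : continuous aff.
  by move=> t; apply: differentiable_continuous; exact: ex_diff.
have : \forall t \near (0 : R), (c @` chart_dom c) (aff t).
  apply: (affc 0); apply: open_nbhs_nbhs; split; first exact: chart_img_open.
  by exists p => //; rewrite /aff scale0r addr0.
move=> /nbhs_ballP[e /= e0 He]; exists e => //.
have {}He t : `|t| < e -> (c @` chart_dom c) (aff t).
  by move=> te; apply: He; rewrite /ball /= sub0r normrN.
have sc t : `|t| < e -> {for t, continuous (straight c p v)}.
  move=> te; apply: (@continuous_comp _ _ _ aff (chart_inv c)); first exact: affc.
  by apply: chart_inv_cts; exact: He.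
split => //; first by rewrite /straight scale0r addr0 chart_mapK.
move=> c' ac'.
set U := [set t | _].
set h := c' \o chart_inv c.
have Uh t : U t -> (c @` (chart_dom c `&` chart_dom c')) (aff t).
  move=> [te c't]; have [x cx cxE] := He _ te; exists x => //; split => //.
  by move: c't; rewrite /straight -/(aff t) -cxE chart_mapK.
have [hd hD] := atlas_compat ac ac' 1.
have compd t : U t -> differentiable (h \o aff) t.
  by move=> /Uh /hd ht; apply: differentiable_comp => //; exact: ex_diff.
have -> : c' \o straight c p v = h \o aff by [].
split => // w t Ut.
have hDE t' : U t' -> 'D_w (h \o aff) t' = 'D_(w *: v) h (aff t').
  move=> Ut'; have ht := hd _ (Uh _ Ut').
  have da : differentiable aff t' by exact: ex_diff.
  rewrite deriveE; last exact: compd.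
  have -> := diff_comp da ht.
  by rewrite deriveE // [LHS]/= (@diff_val _ _ _ _ _ _ _ (affd t')).
have oU : \forall t' \near t, U t'.
  case: (Ut) => te c't.
  have H1 : \forall t' \near t, `|t'| < e.
    exact: (@norm_continuous _ R t _ (@lt_nbhsl _ _ _ te)).
  have H2 : \forall t' \near t, chart_dom c' (straight c p v t').
    by apply: (sc t) => //; apply: open_nbhs_nbhs; split => //;
       exact: chart_dom_open.
  by near=> t'; split; near: t'.
have cD : {for t, continuous ('D_(w *: v) h \o aff)}.
  apply: continuous_comp; first exact: affc.
  by apply: hD; exact: Uh.
have {}cD : ('D_(w *: v) h \o aff) x @[x --> t] --> 'D_w (h \o aff) t.
  by rewrite hDE.
apply: cvg_trans cD; apply: near_eq_cvg.
by apply: filterS oU => t' Ut' /=; rewrite -hDE.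
Unshelve. all: by end_near. Qed.

Lemma is_tangentP (c : chart R n M) p xi : atlas c -> chart_dom c p ->
  reflect (exists v, xi = chart_tangent c p v) (is_tangent p xi).
Proof.
move=> ac cp; apply: (iffP (asboolP _)).
  move=> [eps [gamma [e0 gC ->]]]; exists ('d (c \o gamma) 0 1).
  exact: velocityE gC.
move=> [v ->]; have [eps e0 gC] := straight_C1 v ac cp.
exists eps, (straight c p v); split => //.
rewrite (velocityE ac cp e0 gC); congr chart_tangent.
have cinv : (c @` chart_dom c) (c p) by exists p.
have [_ gc /(_ _ ac)[gd _]] := gC.
have affd := is_diff_line (c p) v 0.
have near_in : \forall t \near (0 : R), c (straight c p v t) = c p + t *: v.
  have affc : {for 0, continuous (fun t : R => c p + t *: v)}.
    exact/differentiable_continuous/ex_diff.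
  have : \forall t \near (0 : R), (c @` chart_dom c) (c p + t *: v).
    apply: affc; rewrite scale0r addr0.
    by apply: open_nbhs_nbhs; split => //; exact: chart_img_open.
  by apply: filterS => t; exact: chart_invK.
rewrite -deriveE; last first.
  by apply: gd; split; rewrite /= ?normr0 // /straight scale0r addr0 chart_mapK.
rewrite (near_eq_derive _ near_in) deriveE; last exact: ex_diff.
by rewrite (@diff_val _ _ _ _ _ _ _ affd) scale1r.
Qed.

Lemma is_tangent_closed p : subsemimod_closed (is_tangent p).
Proof.
have [c ac cp] := atlas_cover p.
split; first split.
- apply/(is_tangentP _ ac cp); exists 0; apply/funext => s.
  by rewrite /chart_tangent linear0 if_same.
- move=> _ _ /(is_tangentP _ ac cp)[v ->] /(is_tangentP _ ac cp)[w ->].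
  apply/(is_tangentP _ ac cp); exists (v + w); apply/funext => s.
  by rewrite /GRing.add /= /chart_tangent linearD; case: ifP => //; rewrite addr0.
- move=> a _ /(is_tangentP _ ac cp)[v ->].
  apply/(is_tangentP _ ac cp); exists (a *: v); apply/funext => s.
  rewrite /GRing.scale /= /chart_tangent linearZ; case: ifP => //.
  by rewrite scaler0.
Qed.

(* The tangent space at p, with the pointwise vector space structure. *)
Record tangent (p : M) := Tangent {
  tangent_val :> (M -> R) -> R;
  tangent_valP : is_tangent p tangent_val }.

HB.instance Definition _ (p : M) := [isSub for @tangent_val p].
HB.instance Definition _ (p : M) := [Choice of tangent p by <:].
HB.instance Definition _ (p : M) :=
  GRing.SubChoice_isSubLmodule.Build R ((M -> R) -> R^o) (is_tangent p)
    (tangent p) (is_tangent_closed p).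

(* The cotangent space at p is the type {scalar tangent p} of linear forms. *)
Definition differential (p : M) (s : M -> R) (xi : tangent p) : R := xi s.

Lemma differential_is_linear p s : scalar (@differential p s).
Proof. by []. Qed.

HB.instance Definition _ p s :=
  GRing.isLinear.Build R (tangent p) R *%R (@differential p s)
    (differential_is_linear s).

End C1.

Section Cones.
Variables (R : realType) (n : nat) (M : smoothManifold R n).

(* Convergence of p_ to p, implicit in the condition on the difference
   quotients, is required explicitly. *)
Definition tangent_cone (Omega : set M) (p : M) : set (tangent p) :=
  [set xi | exists (p_ : nat -> M) (t : nat -> R),
    [/\ forall k, Omega (p_ k),
        forall k, 0 < t k,
        t @ \oo --> 0,
        p_ @ \oo --> p &
        forall s, C1_near p s ->
          ((s (p_ k) - s p) / t k) @[k --> \oo] --> xi s]].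

Definition polar (p : M) (B : set (tangent p)) : set {scalar tangent p} :=
  [set sigma | forall xi, B xi -> sigma xi <= 0].

Variables (m q : nat) (g : M -> 'cV[R]_m) (h : M -> 'cV[R]_q).

Definition feasible : set M :=
  [set p | (forall i, g p i 0 <= 0) /\ h p = 0].

Definition active (p : M) : set 'I_m := [set i | g p i 0 = 0].

Definition linearizing_cone (p : M) : set (tangent p) :=
  [set xi | (forall i, active p i -> xi (fun x => g x i 0) <= 0) /\
            (forall j, xi (fun x => h x j 0) = 0)].

Definition guignard (p : M) : Prop :=
  polar (@linearizing_cone p) = polar (@tangent_cone feasible p).

End Cones.

Definition local_minimizer (R : realType) (n : nat) (M : smoothManifold R n)
    (f : M -> R) (Omega : set M) (p : M) : Prop :=
  Omega p /\ exists2 U, nbhs p U & forall x, (U `&` Omega) x -> f p <= f x.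

Arguments differential {R n M p} s xi.

(* Main.v *)
Require Import Defs.
From mathcomp Require Import all_boot all_order all_algebra.
From mathcomp Require Import all_classical all_reals all_analysis.
From mathcomp Require Import ring lra.
Import Order.TTheory GRing.Theory Num.Theory.
Import numFieldNormedType.Exports.
Local Open Scope classical_set_scope.
Local Open Scope ring_scope.

(** A minimizer satisfies [xi f >= 0] for every [xi] in the tangent cone, i.e.
    [- df] lies in the polar of the tangent cone, which by Guignard's condition
    is the polar of the linearizing cone.  Farkas' lemma, which holds for
    finitely many linear forms on an arbitrary vector space, writes [- df] as a
    combination of the [dg^i] with [i] active and the [dh^j]. *)

(* Bartl's induction: if the last form [b] cannot be dropped, there is [x0] with
   [b x0 = 1], [c x0 > 0] and [a i x0 <= 0] for the other forms; the induction
   hypothesis is applied to the forms composed with the projection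
   [x |-> x - b x *: x0] onto the kernel of [b]. *)
Lemma farkas (R : realFieldType) (V : lmodType R) (m : nat)
    (a : 'I_m -> V -> R) (c : V -> R) :
  (forall i, scalar (a i)) -> scalar c ->
  (forall x, (forall i, a i x <= 0) -> c x <= 0) ->
  exists2 u : 'I_m -> R, forall i, 0 <= u i &
    forall x, c x = \sum_(i < m) u i * a i x.
Proof.
have scalarZ (l : V -> R) k x : scalar l -> l (k *: x) = k * l x.
  move=> ll; have l0 : l 0 = 0 by have := ll 1 0 0; rewrite scaler0 addr0; lra.
  by have := ll k x 0; rewrite addr0 l0 addr0.
elim: m a c => [|m IHm] a c al cl ac.
  (* With no forms the hypothesis on [c] is unconditional: [c] is nonpositive at both [x] and [- x],
     hence zero. *)
  exists (fun=> 0) => // x; rewrite big_ord0; apply/eqP.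
  have cx y : c y <= 0 by apply: ac => -[].
  by rewrite eq_le cx -oppr_le0 -mulN1r -scalarZ ?cx.
have widen_max i : widen_ord (leqnSn m) i = lift ord_max i.
  by apply: ord_inj; rewrite lift_max.
pose a' i := a (widen_ord (leqnSn m) i); pose b := a ord_max.
have aP x : (forall i, a' i x <= 0) -> b x <= 0 -> forall i, a i x <= 0.
  move=> a'x bx i; case: (unliftP ord_max i) => [j|] -> //.
  by rewrite -widen_max; exact: a'x.
have [cP|] := pselect (forall x, (forall i, a' i x <= 0) -> c x <= 0).
  have [u u0 cE] := IHm a' c (fun i => al _) cl cP.
  exists (fun i => if unlift ord_max i is Some j then u j else 0).
    by move=> i; case: unlift.
  move=> x; rewrite big_ord_recr /= unlift_none mul0r addr0 cE.
  by apply: eq_bigr => i _; rewrite /a' widen_max liftK.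
move=> /existsNP[y /not_implyP[a'y /negP]]; rewrite -ltNge => cy.
have by0 : 0 < b y.
  by rewrite ltNge; apply/negP => by0; have := ac _ (aP _ a'y by0); lra.
pose x0 := (b y)^-1 *: y.
have bl : scalar b by exact: al.
have bx0 : b x0 = 1 by rewrite scalarZ // mulVf // gt_eqF.
have a'x0 i : a' i x0 <= 0.
  by rewrite scalarZ; [rewrite pmulr_rle0 ?invr_gt0|exact: al].
have cx0 : 0 < c x0 by rewrite scalarZ // mulr_gt0 // invr_gt0.
(* The projection is written in the shape [k *: u + v], on which [scalar] rewrites directly. *)
have proj (l : V -> R) x : scalar l -> l (- b x *: x0 + x) = l x - l x0 * b x.
  by move=> ll; rewrite ll; ring.
have projl (l : V -> R) : scalar l -> scalar (fun x => l x - l x0 * b x).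
  by move=> ll k x z; rewrite ll bl; ring.
have [|||u u0 cE] := IHm (fun i x => a' i x - a' i x0 * b x)
                         (fun x => c x - c x0 * b x).
- by move=> i; apply: projl; exact: al.
- exact: projl.
- move=> x ax; rewrite -proj //; apply: ac; apply: aP.
    by move=> i; rewrite proj //; exact: al.
  by rewrite proj // bx0; lra.
(* The last weight collects the coefficients of [b x] in [cE]. It is nonnegative because [c x0 > 0]
   while every [a' i x0 <= 0]. *)
exists (fun i => if unlift ord_max i is Some j then u j
                 else c x0 - \sum_(i < m) u i * a' i x0).
  move=> i; case: unlift => // ; rewrite subr_ge0.
  apply: (le_trans _ (ltW cx0)); apply: sumr_le0 => j _.
  exact: mulr_ge0_le0.
move=> x; rewrite big_ord_recr /= unlift_none -/b.
under eq_bigr do rewrite [X in unlift _ X]widen_max liftK.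
have := cE x.
under [X in _ = X -> _]eq_bigr do rewrite mulrBr mulrA.
rewrite sumrB -mulr_suml /a' => cE'.
by rewrite mulrBl -[LHS](subrK (c x0 * b x)) cE'; ring.
Qed.

(** Each equation [b j x = 0] is the pair of inequalities for [b j] and [- b j]. The free-sign
    multiplier [v j] is the difference of their two nonnegative weights. *)
Lemma farkas_eq (R : realFieldType) (V : lmodType R) (m q : nat)
    (a : 'I_m -> V -> R) (b : 'I_q -> V -> R) (c : V -> R) :
  (forall i, scalar (a i)) -> (forall j, scalar (b j)) -> scalar c ->
  (forall x, (forall i, a i x <= 0) -> (forall j, b j x = 0) -> c x <= 0) ->
  exists (u : 'I_m -> R) (v : 'I_q -> R), (forall i, 0 <= u i) /\
    forall x, c x = \sum_(i < m) u i * a i x + \sum_(j < q) v j * b j x.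
Proof.
move=> al bl cl abc.
pose d (i : 'I_(m + (q + q))) (x : V) : R := match fintype.split i with
  | inl i => a i x
  | inr j => match fintype.split j with inl j => b j x | inr j => - b j x end
  end.
have dl i : scalar (d i).
  rewrite /d; case: fintype.split => [j|j]; first exact: al.
  by case: fintype.split => k; [exact: bl | move=> l x y; rewrite bl; ring].
have da i x : d (lshift _ i) x = a i x by rewrite /d (unsplitK (inl i)).
have db j x : d (rshift _ (lshift _ j)) x = b j x.
  by rewrite /d (unsplitK (inr _)) (unsplitK (inl _)).
have dNb j x : d (rshift _ (rshift _ j)) x = - b j x.
  by rewrite /d (unsplitK (inr _)) (unsplitK (inr _)).
have [x dx|w w0 cE] := farkas R V _ d c dl cl.
  apply: abc => [i|j]; first by rewrite -da.
  by apply/eqP; rewrite eq_le -[0 <= _]oppr_le0 -dNb -db !dx.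
exists (fun i => w (lshift _ i)), (fun j => w (rshift _ (lshift _ j)) -
  w (rshift _ (rshift _ j))); split => // x.
rewrite cE big_split_ord; congr +%R.
  by apply: eq_bigr => i _; rewrite da.
rewrite big_split_ord /= -big_split; apply: eq_bigr => j _ /=.
by rewrite db dNb; ring.
Qed.

(** Since [p_ k] tends to [p], it eventually lies in the neighborhood [U] of minimality, so the
    difference quotients of [f] are eventually nonnegative, and so is their limit. *)
Lemma local_minimizer_tangent_cone (R : realType) (n : nat)
    (M : smoothManifold R n) (f : M -> R) (Omega : set M) (p : M)
    (xi : tangent p) :
  C1_near p f -> local_minimizer f Omega p -> tangent_cone Omega xi ->
  0 <= xi f.
Proof.
move=> fC [_ [U Up fmin]] [p_ [t [Op t0 _ pp /(_ _ fC) xif]]].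
apply: (@closed_cvg _ _ \oo _ _ (fun y : R => 0 <= y)) xif.
  exact: closed_ge.
have : \forall k \near \oo, U (p_ k) by exact: pp.
apply: filterS => k Uk; rewrite divr_ge0 ?(ltW (t0 k)) // subr_ge0.
by apply: fmin.
Qed.

Theorem theorem3p12 (R : realType) (n : nat) (M : smoothManifold R n)
    (m q : nat) (f : M -> R) (g : M -> 'cV[R]_m) (h : M -> 'cV[R]_q)
    (pstar : M) :
  C1 f -> C1 g -> C1 h ->
  local_minimizer f (feasible g h) pstar ->
  guignard g h pstar ->
  exists (mu : 'rV[R]_m) (lambda : 'rV[R]_q),
    [/\ (differential f
         + \sum_(i < m) mu 0 i *: differential (fun p => g p i 0)
         + \sum_(j < q) lambda 0 j *: differential (fun p => h p j 0)
         = 0 :> (tangent pstar -> R^o)),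
        h pstar = 0,
        (forall i, 0 <= mu 0 i),
        (forall i, g pstar i 0 <= 0) &
        mu *m g pstar = 0].
Proof.
move=> fC _ _ fmin gq; have [[gp hp] _] := fmin.
have fC1 : C1_near pstar f.
  by exists setT => //; split => //; exact: openT.
pose act i := g pstar i 0 == 0.
(* Inactive constraints become the zero form, whose inequality is vacuous, so the premises of
   Farkas' lemma describe exactly the linearizing cone. *)
pose a i (xi : tangent pstar) : R :=
  if act i then differential (fun p => g p i 0) xi else 0.
have [||||u [v [u0 dfE]]] := farkas_eq R (tangent pstar) m q a
    (fun j => differential (fun p => h p j 0)) (fun xi => - differential f xi).
- by move=> i k x y; rewrite /a; case: ifP => _; [|rewrite mulr0 addr0].
- by move=> j; exact: linearP.
- by move=> k x y; rewrite differential_is_linear; ring.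
- move=> xi gxi hxi.
  have : polar (linearizing_cone g h (p:=pstar)) (\- differential f).
    rewrite gq => eta eta_cone; rewrite oppr_le0.
    exact: local_minimizer_tangent_cone fC1 fmin eta_cone.
  apply; split => // i gi.
  by have := gxi i; rewrite /a /act gi eqxx.
(* Farkas' lemma leaves [u i] arbitrary at inactive [i]. Resetting it to 0 leaves the sum unchanged
   and makes each term of [mu *m g pstar] vanish. *)
exists (\row_i if act i then u i else 0), (\row_j v j); split => //.
- apply/funext => xi; rewrite !fctE !fct_sumE.
  apply/eqP; rewrite -addrA addrC addr_eq0 dfE; apply/eqP; congr +%R.
    by apply: eq_bigr => i _; rewrite mxE /a; case: ifP => _; rewrite ?mulr0 ?scale0r.
  by apply: eq_bigr => j _; rewrite mxE.
- by move=> i; rewrite mxE; case: ifP.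
- apply/matrixP => k l; rewrite !ord1 !mxE big1 // => i _; rewrite mxE.
  by case: ifP => [/eqP->|_]; rewrite ?mulr0 ?mul0r.
Qed.
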